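(* Let $K$ be a field, $L$ an algebraically closed field extension of $K$, $X=\{x_1,\dots,x_n\}$, and let $H=\langle h_1,\dots,h_r\rangle\subseteq K[X]$ (the hypotheses) and $f\in K[X]$ (the thesis) define a statement $\{H\Rightarrow T\}$ with $T=\langle f\rangle$. Let $Y=\{x_1,\dots,x_d\}$ ($0\le d\le n$) be a maximum-size set of independent variables for $H$ (so $d=\dim H$). Then: (a) The statement is generally true if and only if $\langle h_1,\dots,h_r, f\cdot t-1\rangle K[X,t]\cap K[Y]\neq\langle 0\rangle$, where $t$ is a new variable. (b) The statement is generally false if and only if $\langle h_1,\dots,h_r,f\rangle K[X]\cap K[Y]\neq\langle 0\rangle$.
   Context: $V(H)\subseteq L^n$ denotes the common zero set in $L^n$ of the elements of $H$. A set $Y=\{x_1,\dots,x_d\}\subseteq X$ is a maximum-size set of independent variables for $H$ if (i) $H\cap K[Y]=\langle 0\rangle$ and (ii) for every subset $Z\subseteq X$ with more than $d$ elements, $H\cap K[Z]\neq\langle 0\rangle$. The $K$-components of $V(H)$ are its irreducible components as a variety defined over $K$, i.e. the zero sets in $L^n$ of the minimal prime ideals of $H$ in $K[X]$; for such a component $W$, let $I(W)\subseteq K[X]$ be the ideal of polynomials over $K$ vanishing on $W$ (its associated prime). A $K$-component $W$ is non-degenerate (with respect to $Y$) if $I(W)\cap K[Y]=\langle 0\rangle$, and degenerate otherwise. The statement is generally true if $f$ vanishes on all non-degenerate $K$-components of $V(H)$, and generally false if $f$ vanishes identically on none of the non-degenerate $K$-components of $V(H)$. *)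

(* Defs.v *)
From mathcomp Require Import all_boot all_order all_algebra.
From mathcomp Require Import mpoly.
Set Implicit Arguments. Unset Strict Implicit. Unset Printing Implicit Defensive.
Import GRing.Theory.
Local Open Scope ring_scope.

Section Ideals.
Variable R : comRingType.

Definition ideal_gen (s : seq R) : R -> Prop :=
  fun p => exists c : 'I_(size s) -> R, p = \sum_(i < size s) c i * s`_i.

Definition is_ideal (I : R -> Prop) : Prop :=
  [/\ I 0, (forall a b, I a -> I b -> I (a + b)) & (forall a b, I b -> I (a * b))].

Definition is_prime_ideal (P : R -> Prop) : Prop :=
  [/\ is_ideal P, ~ P 1 & (forall a b, P (a * b) -> P a \/ P b)].

Definition minimal_prime_over (I P : R -> Prop) : Prop :=
  [/\ is_prime_ideal P, (forall p, I p -> P p) &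
      (forall Q, is_prime_ideal Q -> (forall p, I p -> Q p) ->
                 (forall p, Q p -> P p) -> forall p, P p -> Q p)].
End Ideals.

Section Vars.
Variables (n : nat) (K : comRingType).

Definition in_vars (Z : {set 'I_n}) (p : {mpoly K[n]}) : Prop :=
  forall m, m \in msupp p -> forall i, i \notin Z -> m i = 0%N.

Definition meets_vars (I : {mpoly K[n]} -> Prop) (Z : {set 'I_n}) : Prop :=
  exists p, [/\ I p, p != 0 & in_vars Z p].

Definition max_indep_set (I : {mpoly K[n]} -> Prop) (Y : {set 'I_n}) : Prop :=
  ~ meets_vars I Y /\
  (forall Z : {set 'I_n}, (#|Y| < #|Z|)%N -> meets_vars I Z).
End Vars.

(* Y = {x_1, ..., x_d}, encoded as the indices i < d (0-based) *)
Definition first_vars (n d : nat) : {set 'I_n} := [set i : 'I_n | (i < d)%N].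

Section ZeroSets.
Variables (n : nat) (K L : comRingType) (iota : {rmorphism K -> L}).

Definition evalL (p : {mpoly K[n]}) (a : 'I_n -> L) : L := (map_mpoly iota p).@[a].

Definition zero_set (I : {mpoly K[n]} -> Prop) : ('I_n -> L) -> Prop :=
  fun a => forall p, I p -> evalL p a = 0.

Definition vanishing_ideal (W : ('I_n -> L) -> Prop) : {mpoly K[n]} -> Prop :=
  fun p => forall a, W a -> evalL p a = 0.

Definition K_component (H : {mpoly K[n]} -> Prop) (W : ('I_n -> L) -> Prop) :=
  exists P, minimal_prime_over H P /\ W = zero_set P.

Definition non_degenerate (Y : {set 'I_n}) (W : ('I_n -> L) -> Prop) : Prop :=
  ~ meets_vars (vanishing_ideal W) Y.

Definition vanishes_on (f : {mpoly K[n]}) (W : ('I_n -> L) -> Prop) : Prop :=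
  forall a, W a -> evalL f a = 0.

Definition generally_true (H : {mpoly K[n]} -> Prop) (Y : {set 'I_n})
  (f : {mpoly K[n]}) : Prop :=
  forall W, K_component H W -> non_degenerate Y W -> vanishes_on f W.

Definition generally_false (H : {mpoly K[n]} -> Prop) (Y : {set 'I_n})
  (f : {mpoly K[n]}) : Prop :=
  forall W, K_component H W -> non_degenerate Y W -> ~ vanishes_on f W.
End ZeroSets.

(* x_i |-> x_i, the new variable t is the last one (index n) *)
Definition lift_var (n : nat) (K : comRingType) (p : {mpoly K[n]}) : {mpoly K[n.+1]} :=
  mmap (@mpolyC n.+1 K) (fun i => 'X_(widen_ord (leqnSn n) i)) p.

Definition tvar (n : nat) (K : comRingType) : {mpoly K[n.+1]} := 'X_(@ord_max n).

Definition first_vars_t (n d : nat) : {set 'I_n.+1} := [set i : 'I_n.+1 | (i < d)%N].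

(* Main.v *)
(* By the Nullstellensatz, a component V(P) is non-degenerate iff P misses
   K[Y] \ {0}, and f vanishes on it iff f is in P, so both claims are about the
   minimal primes P of H missing K[Y] \ {0}.
   (a) Rabinowitsch: K[Y] meets <H, f t - 1> iff g f^N is in H for some nonzero g
   in K[Y] and some N.  Otherwise some minimal prime of H avoids all the g f^N.
   (b) If <H, f> misses K[Y] \ {0}, so does a prime Q containing it, and Q contains
   a minimal prime P of H.  By maximality of Y, K[X]/P is algebraic over K[Y], which
   forces P = Q, hence f in P.
   The Nullstellensatz and the equality P = Q are both obtained by adjoining one
   variable at a time, from [minimal_in_bezout]. *)
Require Import Defs.
From mathcomp Require Import all_boot all_order all_algebra.
From mathcomp Require Import mpoly ring.
From mathcomp Require boolp classical_sets.
Import GRing.Theory.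
Local Open Scope ring_scope.
Set Implicit Arguments. Unset Strict Implicit. Unset Printing Implicit Defensive.

(** * Ideals, prime ideals and minimal primes *)

Lemma ex_minimal (T : Type) (A : T -> Prop) (s : T -> nat) :
  (exists x, A x) -> exists x, A x /\ forall y, A y -> (s x <= s y)%N.
Proof.
case=> x Ax; have [k] := ubnP (s x); elim: k x Ax => // k IHk x Ax; rewrite ltnS => le_k.
have [[y [Ay lt_yx]]|no] := boolp.EM (exists y, A y /\ (s y < s x)%N).
  exact: IHk Ay (leq_trans lt_yx le_k).
exists x; split=> // y Ay; rewrite leqNgt; apply/negP => lt_yx.
by apply: no; exists y.
Qed.

Section IdealTheory.
Variables (R : comNzRingType) (I : R -> Prop).
Hypothesis idI : is_ideal I.

Lemma ideal0 : I 0. Proof. by case: idI. Qed.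

Lemma idealD a b : I a -> I b -> I (a + b). Proof. by case: idI => _ + _; apply. Qed.

Lemma idealMl a b : I b -> I (a * b). Proof. by case: idI => _ _; apply. Qed.

Lemma idealMr a b : I a -> I (a * b). Proof. by rewrite mulrC; apply: idealMl. Qed.

Lemma idealN a : I a -> I (- a). Proof. by rewrite -mulN1r; apply: idealMl. Qed.

Lemma idealB a b : I a -> I b -> I (a - b).
Proof. by move=> Ia Ib; apply/idealD/idealN. Qed.

Lemma ideal_sum (J : Type) (r : seq J) (A : pred J) F :
  (forall i, A i -> I (F i)) -> I (\sum_(i <- r | A i) F i).
Proof. by move=> IF; apply: big_ind; [exact: ideal0 | exact: idealD | exact: IF]. Qed.
End IdealTheory.

Section PrimeTheory.
Variables (R : comNzRingType) (P : R -> Prop).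
Hypothesis prP : is_prime_ideal P.

Lemma prime_ideal : is_ideal P. Proof. by case: prP. Qed.

Lemma prime_mul a b : P (a * b) -> P a \/ P b. Proof. by case: prP => _ _; apply. Qed.

Lemma prime_exp a k : P (a ^+ k) -> P a.
Proof.
elim: k => [|k IHk]; first by rewrite expr0; case: prP.
by rewrite exprS => /prime_mul [].
Qed.

Lemma prime_preim (S : comNzRingType) (g : {rmorphism S -> R}) :
  is_prime_ideal (fun x => P (g x)).
Proof.
case: prP => [[P0 PD PM] P1 Pp]; split=> [||a b]; last 2 first.
- by rewrite rmorph1.
- by rewrite rmorphM; apply: Pp.
by split=> [|a b|a b]; rewrite ?rmorph0 ?rmorphD ?rmorphM //; [apply: PD | apply: PM].
Qed.
End PrimeTheory.

(* The complement of a multiplicative set that is maximal among those avoiding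
   [I] is a minimal prime over [I]. *)
Lemma minimal_prime_avoiding (R : comNzRingType) (I S : R -> Prop) :
  is_ideal I -> S 1 -> (forall a b, S a -> S b -> S (a * b)) ->
  (forall a, S a -> ~ I a) ->
  exists P, minimal_prime_over I P /\ forall a, S a -> ~ P a.
Proof.
move=> idI S1 SM SI.
pose good (M : R -> Prop) :=
  (forall a b, M a -> M b -> M (a * b)) /\ (forall a, M a -> ~ I a).
(* Zorn's lemma also asks for the union of the empty chain, so the condition is put on M ∪ S rather
   than on sets M containing S. *)
pose A (M : R -> Prop) := good (fun a => M a \/ S a).
have [|M [[MM MI] maxM]] := @classical_sets.Zorn_bigcup R A.
  move=> F FA Ftot; split; last first.
    move=> a [[M FM Ma]|Sa]; last exact: SI.
    by have [_] := FA _ FM; apply; left.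
  move=> a b [[M FM Ma]|Sa] [[N FN Nb]|Sb]; last by right; apply: SM.
  - have [MN|NM] := Ftot _ _ FM FN.
      have [/(_ a b)] := FA _ FN; case; [by left; apply: MN | by left | | by right].
      by left; exists N.
    have [/(_ a b)] := FA _ FM; case; [by left | by left; apply: NM | | by right].
    by left; exists M.
  - have [/(_ a b)] := FA _ FM; case; [by left | by right | | by right].
    by left; exists M.
  - have [/(_ a b)] := FA _ FN; case; [by right | by left | | by right].
    by left; exists N.
pose M' a := M a \/ S a.
have {MM}MM a b : M' a -> M' b -> M' (a * b) by apply: MM.
have {MI}MI a : M' a -> ~ I a by apply: MI.
have M1 : M' 1 by right.
have maxM' N : good N -> (forall a, M' a -> N a) -> forall a, N a -> M' a.
  move=> [NM NI] MN a Na; apply: boolp.contrapT => nMa.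
  apply: (maxM N); last first.
    have NS b : N b \/ S b -> N b by case=> // Sb; apply: MN; right.
    split=> [b c /NS Nb /NS Nc|b /NS]; last exact: NI.
    by left; apply: NM.
  split=> [b Mb|eqM]; first by apply: MN; left.
  by apply: nMa; left; apply: eqM.
(* [P a] says that the multiplicative set generated by [M'] and a meets I. By maximality this is the
   complement of [M'], in a form where sums are easy to treat. *)
pose P a := exists m k, M' m /\ I (m * a ^+ k).
have MP a : M' a -> ~ P a.
  move=> Ma [m [k [Mm]]]; apply: MI; apply: (MM) => //.
  by elim: k => [|k IHk]; rewrite ?expr0 // exprS; apply: (MM).
have PM a : ~ M' a -> P a.
  move=> nMa; apply: boolp.contrapT => nPa; apply: nMa.
  (* If no m * a^k lay in I, these products would form a good set containing [M'] and a. *)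
  pose N b := exists m k, M' m /\ b = m * a ^+ k.
  apply: (maxM' N) => [|b Mb|]; last by exists 1, 1%N; rewrite mul1r expr1.
    split=> [b c [m [k [Mm ->]]] [m' [k' [Mm' ->]]]|b [m [k [Mm ->]]] Ib].
      by exists (m * m'), (k + k')%N; split; [apply: MM | rewrite exprD mulrACA].
    by apply: nPa; exists m, k.
  by exists b, 0%N; rewrite expr0 mulr1.
have idP : is_ideal P.
  split=> [|a b [m [k [Mm Ia]]] [m' [k' [Mm' Ib]]]|a b [m [k [Mm Ib]]]].
  - by exists 1, 1%N; rewrite mul1r expr1; split=> //; apply: ideal0.
  - exists (m * m'), (k + k')%N; split; first exact: MM.
    (* Each binomial term of degree k + k' has a factor a^k (if i <= k') or b^k' (otherwise), so m
       or m' completes it to an element of I. *)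
    rewrite exprDn mulr_sumr; apply: ideal_sum => // i _.
    rewrite -mulr_natr !mulrA; apply: idealMr => //.
    have [le_ik|lt_ki] := leqP i k'.
      rewrite -addnBA // exprD.
      rewrite (_ : _ * _ = m' * a ^+ (k' - i) * b ^+ i * (m * a ^+ k)); first exact: idealMl.
      ring.
    rewrite -(subnK (ltnW lt_ki)) exprD.
    rewrite (_ : _ * _ = (m * a ^+ (k + k' - (i - k' + k')) * b ^+ (i - k')) * (m' * b ^+ k')).
      exact: idealMl.
    ring.
  - exists m, k; split=> //; rewrite exprMn mulrCA; exact: idealMl.
exists P; split; last by move=> a Sa; apply: MP; right.
split=> [|p Ip|Q prQ IQ QP p [m [k [Mm Imp]]]].
- split=> // [|a b Pab]; first exact: MP.
  apply: boolp.contrapT => /boolp.not_orP [nPa nPb]; apply: MP Pab; apply: MM.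
    by apply: boolp.contrapT => /PM.
  by apply: boolp.contrapT => /PM.
- by apply: PM => /MI.
(* m lies outside P, hence outside Q, so the prime Q must contain p^k. *)
- have [/QP /(MP _ Mm) //|] := prime_mul prQ (IQ _ Imp).
  exact: prime_exp.
Qed.

(** * Prime ideals of a univariate polynomial ring *)

Section PolynomialPrimes.
Variables (R : idomainType) (P : {poly R} -> Prop).
Hypothesis prP : is_prime_ideal P.
Let idP := prime_ideal prP.

(* [p] lies in the ideal of [{poly R}] generated by the contraction of [P] to [R]. *)
Definition extended (p : {poly R}) := forall i, P (p`_i)%:P.

Lemma extended_mem p : extended p -> P p.
Proof.
move=> ext_p; rewrite -[p]coefK poly_def; apply: (ideal_sum idP) => // i _.
by rewrite -mul_polyC; apply: (idealMr idP).
Qed.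

Definition drop_lead (p : {poly R}) := p - (lead_coef p)%:P * 'X^((size p).-1).

Lemma size_drop_lead p : p != 0 -> (size (drop_lead p) < size p)%N.
Proof.
move=> p_neq0; rewrite -(prednK (n := size p)) ?size_poly_gt0 // ltnS.
apply/leq_sizeP => j le_j; rewrite coefB coefCM coefXn lead_coefE.
case: eqP => [->|/eqP ne_j]; first by rewrite mulr1 subrr.
rewrite mulr0 subr0; apply: nth_default.
by rewrite -(prednK (n := size p)) ?size_poly_gt0 // ltn_neqAle eq_sym ne_j.
Qed.

(** Plays the role of the minimal polynomial of the class of X over the fraction field of R/(P ∩ R),
    with denominators cleared. *)
Definition minimal_in (h : {poly R}) :=
  [/\ P h, ~ P (lead_coef h)%:P & forall p, P p -> (size p < size h)%N -> extended p].

(** Take h of least size among the non-extended elements of P. Were its leading coefficient in P,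
    the rest of h would be a smaller element of P, hence extended, and so would h be. *)
Lemma ex_minimal_in h0 : P h0 -> ~ extended h0 -> exists h, minimal_in h.
Proof.
move=> Ph0 next0.
have [|h [[Ph next] min_h]] :=
  @ex_minimal _ (fun h => P h /\ ~ extended h) (fun h => size h); first by exists h0.
have ext_lt p : P p -> (size p < size h)%N -> extended p.
  move=> Pp lt_ph; apply: boolp.contrapT => next_p.
  by have := min_h p (conj Pp next_p); rewrite leqNgt lt_ph.
exists h; split=> // Plead; apply: next => i.
have [->|h_neq0] := eqVneq h 0; first by rewrite coef0; apply: (ideal0 idP).
have Pd : P (drop_lead h) by apply: (idealB idP) => //; apply: (idealMr idP).
have := ext_lt _ Pd (size_drop_lead h_neq0) i.
rewrite coefB coefCM coefXn lead_coefE.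
by case: eqP => [-> _|_]; [ | rewrite mulr0 subr0].
Qed.

(** Pseudo-division by h: the remainder lies in P and is smaller than h. *)
Lemma minimal_in_divp h p : minimal_in h -> P p ->
  exists k s r, [/\ lead_coef h ^+ k *: p = s * h + r & extended r].
Proof.
move=> [Ph nPlead ext_lt] Pp.
have h_neq0 : h != 0.
  by apply/eqP => h0; apply: nPlead; rewrite h0 lead_coef0; apply: (ideal0 idP).
exists (scalp p h), (p %/ h), (p %% h).
have eqp := Pdiv.WeakIdomain.divp_eq p h; split=> //.
apply: ext_lt; last by rewrite ltn_modp.
rewrite (_ : p %% h = lead_coef h ^+ scalp p h *: p - p %/ h * h).
  by apply: (idealB idP) => //; [rewrite -mul_polyC|]; apply: (idealMl idP).
by rewrite eqp addrC addKr.
Qed.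

(* [q] is invertible modulo [P] after inverting one element of [R] outside [P]:
   an element of least degree in (P, q) \ P must be constant. *)
Lemma minimal_in_bezout h q : minimal_in h -> ~ P q ->
  exists b v w, [/\ ~ P b%:P, P w & b%:P = w + v * q].
Proof.
move=> minh nPq; have [Ph nPlh ext_lt] := minh.
have h_neq0 : h != 0.
  by apply/eqP => h0; apply: nPlh; rewrite h0 lead_coef0; apply: (ideal0 idP).
pose B r := ~ P r /\ exists v w : {poly R}, P w /\ r = w + v * q.
have [|r [[nPr [v [w [Pw def_r]]]] min_r]] := @ex_minimal _ B (fun r => size r).
  by exists q; split=> //; exists 1, 0; rewrite add0r mul1r; split=> //; apply: (ideal0 idP).
have r_neq0 : r != 0 by apply/eqP => r0; apply: nPr; rewrite r0; apply: (ideal0 idP).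
have Bw r' : (exists v w : {poly R}, P w /\ r' = w + v * q) -> (size r' < size r)%N -> P r'.
  move=> vw lt_r; apply: boolp.contrapT => nP.
  by have := min_r r' (conj nP vw); rewrite leqNgt lt_r.
(* Otherwise r without its leading term is a smaller element of (P, q), hence in P, and r
   follows. *)
have nPlr : ~ P (lead_coef r)%:P.
  move=> Plr; apply: nPr.
  have Plm : P ((lead_coef r)%:P * 'X^((size r).-1)) by apply: (idealMr idP).
  rewrite -[r](subrK ((lead_coef r)%:P * 'X^((size r).-1))); apply: (idealD idP) => //.
  apply: Bw (size_drop_lead r_neq0).
  exists v, (w - (lead_coef r)%:P * 'X^((size r).-1)); split; first exact: (idealB idP).
  by rewrite /drop_lead {1}def_r addrAC.
(* The pseudo-remainder of q by h is in (P, q) but not in P, since the leading coefficient of h is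
   outside P. *)
have lt_rh : (size r < size h)%N.
  have eqq := Pdiv.WeakIdomain.divp_eq q h.
  have def_m : q %% h = lead_coef h ^+ scalp q h *: q - q %/ h * h.
    by rewrite eqq addrC addKr.
  apply: (@leq_ltn_trans (size (q %% h))); last by rewrite ltn_modp.
  apply: min_r; split.
    move=> Pm; have : P (lead_coef h ^+ scalp q h *: q).
      by rewrite eqq; apply: (idealD idP) => //; apply: (idealMl idP).
    rewrite -mul_polyC => /(prime_mul prP) [] //.
    by rewrite rmorphXn => /(prime_exp prP).
  exists (lead_coef h ^+ scalp q h)%:P, (- (q %/ h * h)).
  by rewrite def_m mul_polyC addrC; split=> //; apply: (idealN idP) => //; apply: (idealMl idP).
have eqh := Pdiv.WeakIdomain.divp_eq h r.
have def_m : h %% r = lead_coef r ^+ scalp h r *: h - h %/ r * r.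
  by rewrite eqh addrC addKr.
(* The pseudo-remainder of h by r is in (P, q) and smaller than r, so it is in P. Then quotient
   times r is in P, and so is the quotient, r being outside. *)
have Pm : P (h %% r).
  apply: Bw; last by rewrite ltn_modp.
  exists (- (h %/ r) * v), (lead_coef r ^+ scalp h r *: h - h %/ r * w).
  rewrite def_m; split; last by rewrite -addrA !mulNr -opprD -mulrA -mulrDr -def_r.
  by apply: (idealB idP) => //; [rewrite -mul_polyC|]; apply: (idealMl idP).
have Ps : P (h %/ r).
  have : P (h %/ r * r).
    rewrite (_ : _ * _ = lead_coef r ^+ scalp h r *: h - h %% r).
      by apply: (idealB idP) => //; rewrite -mul_polyC; apply: (idealMl idP).
    by rewrite eqh addrK.
  by case/(prime_mul prP).
(* For nonconstant r, quotient and remainder are both smaller than h, hence extended. The top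
   coefficient of the division identity then puts a product of leading coefficients outside P into
   P. *)
have size_r : (size r <= 1)%N.
  rewrite leqNgt; apply/negP => size_r.
  have lt_s : (size (h %/ r)%R < size h)%N.
    rewrite size_divp // ltn_subrL -ltnS prednK ?size_r ?size_poly_gt0 //; exact: ltnW.
  have lt_m : (size (h %% r)%R < size h)%N.
    by apply: ltn_trans lt_rh; rewrite ltn_modp.
  have ext_s := ext_lt _ Ps lt_s; have ext_m := ext_lt _ Pm lt_m.
  have : P (lead_coef r ^+ scalp h r * lead_coef h)%:P.
    rewrite lead_coefE -coefZ eqh coefD polyCD.
    apply: (idealD idP); last exact: ext_m.
    rewrite coefM rmorph_sum; apply: (ideal_sum idP) => i _ /=.
    by rewrite polyCM; apply: (idealMr idP).
  rewrite polyCM rmorphXn => /(prime_mul prP) [/(prime_exp prP)|] //.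
exists r`_0, v, w; split=> //; last by rewrite -def_r -size1_polyC.
by rewrite -size1_polyC.
Qed.
End PolynomialPrimes.

Lemma extended_or_minimal (R : idomainType) (P : {poly R} -> Prop) :
  is_prime_ideal P -> (forall p, P p -> extended P p) \/ exists h, minimal_in P h.
Proof.
move=> prP.
have [[h [Ph next]]|no] := boolp.EM (exists h, P h /\ ~ extended P h).
  by right; apply: ex_minimal_in Ph next.
by left=> p Pp; apply: boolp.contrapT => next; apply: no; exists p.
Qed.

(** One step of the Nullstellensatz: a morphism killing P ∩ R but not b extends to R[X], killing P
    but not q. If P is extended from R, any non-root of the image of q serves as t; otherwise t is a
    root of the image of a minimal h. *)
Lemma prime_root_extension (R : idomainType) (L : closedFieldType)
    (P : {poly R} -> Prop) (q : {poly R}) :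
  is_prime_ideal P -> ~ P q ->
  exists b, ~ P b%:P /\
    forall phi : {rmorphism R -> L}, (forall c, P c%:P -> phi c = 0) -> phi b != 0 ->
    exists t, (forall p, P p -> (map_poly phi p).[t] = 0) /\ (map_poly phi q).[t] != 0.
Proof.
move=> prP nPq; have idP := prime_ideal prP.
have ext0 (phi : {rmorphism R -> L}) p : (forall c, P c%:P -> phi c = 0) ->
    extended P p -> map_poly phi p = 0.
  by move=> phi0 extp; apply/polyP=> i; rewrite coef_map coef0; apply: phi0.
have [ext|[h minh]] := extended_or_minimal prP.
  have [i nPi] : exists i, ~ P (q`_i)%:P.
    apply: boolp.contrapT => no; apply: nPq; apply: extended_mem => // i.
    by apply: boolp.contrapT => nPi; apply: no; exists i.
  exists q`_i; split=> // phi phi0 phi_i.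
  have /closed_nonrootP[t nroot_t] : map_poly phi q != 0.
    by apply: contraNneq phi_i => q0; rewrite -coef_map q0 coef0.
  by exists t; split=> // p /ext /ext0 ->; rewrite ?horner0.
have [Ph nPlh _] := minh.
have [b [v [w [nPb Pw def_b]]]] := minimal_in_bezout prP minh nPq.
(* The factor [lead_coef h] keeps the image of h nonconstant and can be cancelled after
   pseudo-division; the factor b keeps q nonzero at t through the Bezout identity. *)
exists (b * lead_coef h); split; first by rewrite polyCM => /(prime_mul prP) [].
move=> phi phi0; rewrite rmorphM mulf_eq0 => /norP [phi_b phi_lh].
have /closed_rootP [t /eqP root_t] : size (map_poly phi h) != 1%N.
  rewrite size_map_poly_id0 //; apply/negP => /size_poly1P [c _ def_h].
  by apply: nPlh; rewrite {1}def_h lead_coefC -def_h.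
have P0 p : P p -> (map_poly phi p).[t] = 0.
  move=> Pp; have [k [s [r [eqp ext_r]]]] := minimal_in_divp prP minh Pp.
  have := congr1 (fun u => (map_poly phi u).[t]) eqp.
  rewrite /= map_polyZ hornerZ rmorphXn rmorphD rmorphM hornerD hornerM /= root_t.
  rewrite (ext0 _ r) // mulr0 horner0 addr0 => /eqP.
  by rewrite mulf_eq0 expf_eq0 (negPf phi_lh) andbF => /eqP.
exists t; split=> //; apply: contraNneq phi_b => q0.
have := congr1 (fun u => (map_poly phi u).[t]) def_b.
by rewrite /= map_polyC hornerC rmorphD rmorphM hornerD hornerM /= q0 mulr0 addr0 P0 // => ->.
Qed.

Lemma mpoly_rmorph_ext n (K S : comNzRingType) (f g : {rmorphism {mpoly K[n]} -> S}) :
  (forall c, f c%:MP = g c%:MP) -> (forall i, f 'X_i = g 'X_i) -> f =1 g.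
Proof.
move=> eqC eqX p; rewrite [p]mpolyE !rmorph_sum; apply: eq_bigr => m _.
rewrite -mul_mpolyC !rmorphM mpolyXE_id !rmorph_prod /=; congr (_ * _); first exact: eqC.
by apply: eq_bigr => i _; rewrite !rmorphXn; congr (_ ^+ _); apply: eqX.
Qed.

(** * Splitting off the last variable *)

Section LastVariable.
Variables (n : nat) (K : comNzRingType).

(** Substitutes the last variable for the indeterminate, undoing [muni]. As a composite of morphisms
    it allows primes to be pulled back along it. *)
Definition of_uni : {rmorphism {poly {mpoly K[n]}} -> {mpoly K[n.+1]}} :=
  horner_eval 'X_ord_max \o map_poly (@mwiden n K).

Lemma of_uniC c : of_uni c%:P = mwiden c.
Proof. by rewrite /= /horner_eval map_polyC hornerC. Qed.

Lemma lift_ord_max (j : 'I_n) : lift ord_max j = widen_ord (leqnSn n) j.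
Proof. by apply/val_inj; rewrite /= /bump leqNgt ltn_ord. Qed.

Lemma muniK : cancel (@muni n K) of_uni.
Proof.
move=> p; rewrite muniE rmorph_sum [RHS]mpolyE; apply: eq_bigr => m _.
rewrite /= /horner_eval !map_polyZ map_polyXn !hornerZ hornerXn.
rewrite /= mwidenZ mwidenX -scalerAl mpolyXn -mpolyXD; congr (_ *: 'X_[_]).
apply/mnmP => i; rewrite mnmDE mulmnE mnm1E.
have [j ->|->] := unliftP ord_max i.
  rewrite lift_ord_max mnmwiden_widen mnmE (_ : (_ == _) = false) ?mul0n ?addn0 //.
  by apply/eqP => /(congr1 val) /= eq_nj; have := ltn_ord j; rewrite -eq_nj ltnn.
by rewrite mnmwiden_ordmax eqxx mul1n.
Qed.

Lemma mnm_widenK (m : 'X_{1..n.+1}) : m ord_max = 0%N ->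
  mnmwiden [multinom m (widen_ord (leqnSn n) i) | i < n] = m.
Proof.
move=> m0; apply/mnmP => i; have [j ->|->] := unliftP ord_max i; last first.
  by rewrite mnmwiden_ordmax.
by rewrite lift_ord_max mnmwiden_widen mnmE.
Qed.

Lemma mwiden_sum (J : eqType) (r : seq J) (F : J -> {mpoly K[n]}) :
  mwiden (\sum_(j <- r) F j) = \sum_(j <- r) mwiden (F j).
Proof. exact: (raddf_sum (@mwiden n K)). Qed.

Lemma msupp_mwiden_max (p : {mpoly K[n]}) m : m \in msupp (mwiden p) -> m ord_max = 0%N.
Proof.
rewrite mcoeff_msupp => nz; apply/eqP; apply: contraNT nz => m_max.
rewrite [p]mpolyE mwiden_sum raddf_sum big1 // => k _ /=.
rewrite mwidenZ mwidenX mcoeffZ mcoeffX; case: eqP => [def_m|_]; last by rewrite mulr0.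
by rewrite -def_m mnmwiden_ordmax in m_max.
Qed.

Lemma in_vars_mwiden (Z : {set 'I_n.+1}) (p : {mpoly K[n]}) :
  in_vars Z (mwiden p) <-> in_vars [set i | widen_ord (leqnSn n) i \in Z] p.
Proof.
split=> [vp m supp_m i|vp m supp_m i nZi].
  rewrite inE => nZi; rewrite -mnmwiden_widen; apply: vp nZi.
  by rewrite mcoeff_msupp mwiden_mnmwiden -mcoeff_msupp.
have m_max := msupp_mwiden_max supp_m; move: nZi; have [j ->|-> //] := unliftP ord_max i.
move: supp_m; rewrite lift_ord_max -(mnm_widenK m_max) mnmwiden_widen mcoeff_msupp.
rewrite mwiden_mnmwiden -mcoeff_msupp => supp_m nZj; apply: vp supp_m _ _.
by rewrite inE.
Qed.

Lemma mwiden_eq0 (p : {mpoly K[n]}) : (mwiden p == 0) = (p == 0).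
Proof. by rewrite -{1}(mwiden0 n K) (inj_eq (@inj_mwiden n K)). Qed.

Lemma first_vars_widen d :
  [set i | widen_ord (leqnSn n) i \in first_vars n.+1 d] = first_vars n d.
Proof. by apply/setP => i; rewrite !inE. Qed.

Lemma in_vars_mwidenP (Z : {set 'I_n.+1}) (p : {mpoly K[n.+1]}) :
  ord_max \notin Z -> in_vars Z p -> exists p', p = mwiden p'.
Proof.
move=> nZ vp.
exists (\sum_(m <- msupp p) p@_m *: 'X_[[multinom m (widen_ord (leqnSn n) i) | i < n]]).
rewrite mwiden_sum [LHS]mpolyE; apply: eq_big_seq => m supp_m /=.
by rewrite mwidenZ mwidenX mnm_widenK //; apply: vp supp_m _ _.
Qed.

Lemma in_vars_coef_muni d (p : {mpoly K[n.+1]}) k :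
  in_vars (ord_max |: first_vars n.+1 d) p -> in_vars (first_vars n d) (muni p)`_k.
Proof.
move=> vp m supp_m i; rewrite inE => le_di; apply/eqP; move: supp_m.
rewrite mcoeff_msupp; apply: contraNT => m_i.
rewrite muniE coef_sum raddf_sum big_seq big1 // => m' supp_m'.
rewrite coefZ coefXn mulr_natr /= mcoeffMn mcoeffZ mcoeffX.
have [def_m|] := eqVneq [multinom m' (widen_ord (leqnSn n) i0) | i0 < n] m.
  case/negP: m_i; rewrite -def_m mnmE; apply/eqP; apply: vp supp_m' _ _.
  rewrite !inE negb_or le_di andbT; apply/eqP => /(congr1 val) /= eq_in.
  by have := ltn_ord i; rewrite eq_in ltnn.
by rewrite mulr0 mul0rn.
Qed.
End LastVariable.

(** * Evaluation in L and the Nullstellensatz for primes *)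

Section Evaluation.
Variables (K : fieldType) (L : closedFieldType) (iota : {rmorphism K -> L}).

Definition evalL_rmorph n (a : 'I_n -> L) : {rmorphism {mpoly K[n]} -> L} :=
  meval a \o map_mpoly iota.

Lemma evalLE n a (p : {mpoly K[n]}) : evalL iota p a = evalL_rmorph a p.
Proof. by []. Qed.

Lemma evalLC n a c : evalL iota (c%:MP : {mpoly K[n]}) a = iota c.
Proof. by rewrite /evalL map_mpolyC mevalC. Qed.

Lemma evalLX n a i : evalL iota ('X_i : {mpoly K[n]}) a = a i.
Proof. by rewrite /evalL map_mpolyX mevalXU. Qed.

Lemma evalL_mwiden n a (p : {mpoly K[n]}) :
  evalL iota (mwiden p) a = evalL iota p (fun i => a (widen_ord (leqnSn n) i)).
Proof.
apply: (mpoly_rmorph_ext (f := evalL_rmorph a \o @mwiden n K) (g := evalL_rmorph _)).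
  by move=> c; rewrite /= mwidenC -!/(evalL iota _ _) !evalLC.
by move=> i; rewrite /= mwidenX mnmwiden1 -!/(evalL iota _ _) !evalLX.
Qed.

Definition snoc_point n (a : 'I_n -> L) (t : L) (i : 'I_n.+1) : L :=
  if unlift ord_max i is Some j then a j else t.

Lemma evalL_snoc_mwiden n (a : 'I_n -> L) t p :
  evalL iota (mwiden p) (snoc_point a t) = evalL iota p a.
Proof.
rewrite evalL_mwiden /evalL; apply: meval_eq => i.
by rewrite /snoc_point -lift_ord_max liftK.
Qed.

Lemma evalL_snoc_max n (a : 'I_n -> L) t :
  evalL iota 'X_ord_max (snoc_point a t) = t.
Proof. by rewrite evalLX /snoc_point unlift_none. Qed.

Lemma evalL_snoc n (a : 'I_n -> L) t p :
  evalL iota p (snoc_point a t) = (map_poly (evalL_rmorph a) (muni p)).[t].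
Proof.
rewrite -{1}[p]muniK evalLE; set chi := evalL_rmorph _.
have -> u : chi (of_uni n K u) = (map_poly (chi \o @mwiden n K) u).[chi 'X_ord_max].
  by rewrite (map_poly_comp chi (@mwiden n K)) horner_map.
rewrite -evalLE evalL_snoc_max; congr _.[_].
by apply: eq_map_poly => u; apply: evalL_snoc_mwiden.
Qed.

(** Induction on n: the contraction of P to the first n variables has a zero a where the element b
    of [prime_root_extension] does not vanish, and a last coordinate t is then added. *)
Lemma prime_separating_point n (P : {mpoly K[n]} -> Prop) q :
  is_prime_ideal P -> ~ P q -> exists a, zero_set iota P a /\ evalL iota q a != 0.
Proof.
elim: n P q => [|n IHn] P q prP nPq.
  have pC (p : {mpoly K[0]}) : p = (p@_0)%:MP.
    by apply/mpolyP => m; rewrite mcoeffC (_ : m = 0%MM) ?eqxx ?mulr1 //; apply/mnmP => -[].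
  (* Without variables the ring is K, whose only prime is zero. *)
  have P0 p : P p -> p = 0.
    rewrite [p]pC; have [->|nz] := eqVneq p@_0 0; rewrite ?mpolyC0 // => Pp.
    case: (prP) => idP nP1 _; case: nP1.
    by rewrite -mpolyC1 -(mulVf nz) mpolyCM; apply: (idealMl idP).
  exists (fun _ => 0); split=> [p /P0 ->|]; first by rewrite evalLE rmorph0.
  rewrite [q]pC evalLC fmorph_eq0; apply/eqP => q0; apply: nPq.
  by rewrite [q]pC q0 mpolyC0; exact: (ideal0 (prime_ideal prP)).
have [|b [nPb ext]] := prime_root_extension L (prime_preim prP (@of_uni n K)) (q := muni q).
  by rewrite muniK.
have [|a [Pa nz_b]] := IHn _ b (prime_preim prP (@mwiden n K)).
  by move=> Pb; apply: nPb; rewrite of_uniC.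
have [c Pc|//|t [Pt nz_q]] := ext (evalL_rmorph a).
  by apply: Pa; move: Pc; rewrite of_uniC.
exists (snoc_point a t); rewrite evalL_snoc; split=> // p Pp.
by rewrite evalL_snoc; apply: Pt; rewrite muniK.
Qed.

Lemma vanishing_ideal_zero_set n (P : {mpoly K[n]} -> Prop) p :
  is_prime_ideal P -> vanishing_ideal iota (zero_set iota P) p <-> P p.
Proof.
move=> prP; split=> [van_p|Pp a]; last exact.
apply: boolp.contrapT => /(prime_separating_point prP) [a [Pa /eqP]].
by case; apply: van_p.
Qed.
End Evaluation.

(** * Comparing nested primes that miss K[Y] *)

Lemma eq0_of_in_all_vars n d (K : comNzRingType) (Q : {mpoly K[n]} -> Prop) q :
  (n <= d)%N -> ~ meets_vars Q (first_vars n d) -> Q q -> q = 0.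
Proof.
move=> le_nd nQ Qq; have [//|nz] := eqVneq q 0; case: nQ; exists q; split=> // m _ i.
by rewrite inE (leq_trans (ltn_ord i)).
Qed.

(* Both [P] and [Q] miss K[Y] and K[X]/P is algebraic over K[Y], so there is no
   room for a strict inclusion. *)
Lemma prime_over_eq (K : fieldType) n d (P Q : {mpoly K[n]} -> Prop) :
  is_prime_ideal P -> is_prime_ideal Q -> (forall p, P p -> Q p) ->
  ~ meets_vars Q (first_vars n d) ->
  (forall i : 'I_n, (d <= i)%N -> meets_vars P (i |: first_vars n d)) ->
  forall q, Q q -> P q.
Proof.
move=> prP prQ PQ nQY PY q Qq; have [le_nd|] := leqP n d.
  by rewrite (eq0_of_in_all_vars le_nd nQY Qq); exact: (ideal0 (prime_ideal prP)).
elim: n P Q prP prQ PQ nQY PY q Qq => // n IHn P Q prP prQ PQ nQY PY q Qq.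
rewrite ltnS => le_dn.
have nQ'Y : ~ meets_vars (fun c => Q (mwiden c)) (first_vars n d).
  case=> p [Qp nz vp]; apply: nQY; exists (mwiden p); rewrite mwiden_eq0; split=> //.
  by apply/in_vars_mwiden; rewrite first_vars_widen.
(* The contractions of P and Q to the first n variables agree by induction. If d = n, that ring is
   K[Y] and the contraction of Q is zero. *)
have sub_widen c : Q (mwiden c) -> P (mwiden c).
  move=> Qc; have [le_nd|lt_dn] := leqP n d.
    rewrite (eq0_of_in_all_vars le_nd nQ'Y Qc) mwiden0; exact: (ideal0 (prime_ideal prP)).
  apply: (IHn (fun c => P (mwiden c)) (fun c => Q (mwiden c))) => //.
  - exact: (prime_preim prP).
  - exact: (prime_preim prQ).
  - by move=> p /PQ.
  move=> i le_di; have [//|p [Pp nz vp]] := PY (widen_ord (leqnSn n) i).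
  have [|p' def_p] := in_vars_mwidenP _ vp.
    rewrite !inE negb_or -leqNgt le_dn andbT; apply/eqP => /(congr1 val) /= eq_ni.
    by have := ltn_ord i; rewrite -eq_ni ltnn.
  exists p'; rewrite -mwiden_eq0 -def_p; split=> //; move: vp; rewrite def_p => /in_vars_mwiden.
  rewrite (_ : [set j | _] = i |: first_vars n d) //.
  by apply/setP => j; rewrite !inE -!(inj_eq val_inj).
apply: boolp.contrapT => nPq.
(* h is an algebraic relation for the last variable over K[Y]. Were P extended from its contraction,
   a nonzero coefficient of h would lie in P, hence in Q, and in K[Y]. *)
have [//|h [Ph nz_h vh]] := PY ord_max.
have [k nz_k] : exists k, (muni h)`_k != 0.
  exists (size (muni h)).-1; rewrite -lead_coefE lead_coef_eq0.
  by apply: contraNneq nz_h => h0; rewrite -[h]muniK h0 rmorph0.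
have prP' := prime_preim prP (@of_uni n K).
have [ext|[h' minh]] := extended_or_minimal prP'.
  case: nQ'Y; exists (muni h)`_k; split=> //; last exact: in_vars_coef_muni.
  by rewrite -of_uniC; apply: PQ; apply: ext; rewrite muniK.
(* b is free of the last variable, outside P, and in Q as a combination of w and q. This contradicts
   the agreement of the contractions. *)
have [|b [v [w [nPb Pw def_b]]]] := minimal_in_bezout prP' minh (q := muni q).
  by rewrite muniK.
apply: nPb; rewrite of_uniC; apply: sub_widen; rewrite -of_uniC def_b rmorphD rmorphM muniK.
have idQ := prime_ideal prQ.
by apply: (idealD idQ); [apply: PQ | apply: (idealMl idQ)].
Qed.

(** * Finitely generated ideals and polynomials in a subset of the variables *)

Section GeneratedIdeals.
Variables (R : comNzRingType).
Implicit Types s : seq R.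

Lemma ideal_genP s : is_ideal (ideal_gen s).
Proof.
split=> [|_ _ [c ->] [c' ->]|a _ [c ->]].
- by exists (fun _ => 0); rewrite big1 // => i _; rewrite mul0r.
- by exists (fun i => c i + c' i); rewrite -big_split; apply: eq_bigr => i _; rewrite mulrDl.
- by exists (fun i => a * c i); rewrite mulr_sumr; apply: eq_bigr => i _; rewrite mulrA.
Qed.

Lemma ideal_gen_mem s x : x \in s -> ideal_gen s x.
Proof.
move=> /(nthP 0) [i lt_i <-]; exists (fun j => (j == Ordinal lt_i)%:R).
rewrite (bigD1 (Ordinal lt_i)) //= eqxx mul1r big1 ?addr0 // => j /negPf ->.
by rewrite mul0r.
Qed.

Lemma ideal_gen_min s (I : R -> Prop) :
  is_ideal I -> (forall x, x \in s -> I x) -> forall p, ideal_gen s p -> I p.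
Proof.
move=> idI sI _ [c ->]; apply: (ideal_sum idI) => i _; apply: (idealMl idI).
by apply: sI; rewrite mem_nth.
Qed.
End GeneratedIdeals.

Lemma in_varsM n (K : comNzRingType) (Z : {set 'I_n}) (p q : {mpoly K[n]}) :
  in_vars Z p -> in_vars Z q -> in_vars Z (p * q).
Proof.
move=> vp vq m /msuppM_le /allpairsP [[m1 m2] /= [m1p m2q ->]] i nZi.
by rewrite mnmDE (vp m1) ?(vq m2).
Qed.

Lemma in_vars1 n (K : comNzRingType) (Z : {set 'I_n}) : in_vars Z (1 : {mpoly K[n]}).
Proof. by move=> m; rewrite msupp1 inE => /eqP -> i _; rewrite mnm0E. Qed.

(** * Components as minimal primes, and the two criteria *)

Section Components.
Variables (K : fieldType) (L : closedFieldType) (iota : {rmorphism K -> L}).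
Variables (n d : nat) (hs : seq {mpoly K[n]}) (f : {mpoly K[n]}).
Let H := ideal_gen hs.
Let Y := first_vars n d.

(** By the Nullstellensatz the vanishing ideal of V(P) is P, which turns conditions on a component
    into conditions on its prime. *)
Lemma K_component_prime W : K_component iota H W -> non_degenerate iota Y W ->
  exists P, [/\ minimal_prime_over H P, ~ meets_vars P Y,
                W = zero_set iota P & vanishes_on iota f W <-> P f].
Proof.
move=> [P [minP ->]] ndeg; have [prP _ _] := minP; exists P; split=> //.
  case=> p [Pp nz vp]; apply: ndeg; exists p; split=> //.
  exact/(vanishing_ideal_zero_set iota).
exact: (vanishing_ideal_zero_set iota).
Qed.

Lemma prime_K_component P : minimal_prime_over H P -> ~ meets_vars P Y ->
  [/\ K_component iota H (zero_set iota P), non_degenerate iota Y (zero_set iota P) &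
      vanishes_on iota f (zero_set iota P) <-> P f].
Proof.
move=> minP nPY; have [prP _ _] := minP; split.
- by exists P.
- case=> p [van_p nz vp]; apply: nPY; exists p; split=> //.
  exact/(vanishing_ideal_zero_set iota).
- exact: (vanishing_ideal_zero_set iota).
Qed.

Lemma generally_trueP : generally_true iota H Y f <->
  forall P, minimal_prime_over H P -> ~ meets_vars P Y -> P f.
Proof.
split=> [gt P minP nPY|gt W KW ndeg].
  by have [KW ndeg <-] := prime_K_component minP nPY; apply: gt.
by have [P [minP nPY _ ->]] := K_component_prime KW ndeg; apply: gt.
Qed.

Lemma generally_falseP : generally_false iota H Y f <->
  forall P, minimal_prime_over H P -> ~ meets_vars P Y -> ~ P f.
Proof.
split=> [gf P minP nPY|gf W KW ndeg].
  by have [KW ndeg <-] := prime_K_component minP nPY; apply: gf.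
by have [P [minP nPY _ ->]] := K_component_prime KW ndeg; apply: gf.
Qed.

Let nonzeroY (g : {mpoly K[n]}) := g != 0 /\ in_vars Y g.

Let nonzeroY1 : nonzeroY 1.
Proof. by split; [rewrite oner_eq0 | apply: in_vars1]. Qed.

Let nonzeroYM g g' : nonzeroY g -> nonzeroY g' -> nonzeroY (g * g').
Proof. by move=> [nz v] [nz' v']; split; [rewrite mulf_neq0 | apply: in_varsM]. Qed.

(** Kept in terms of [lift_var] as in the theorem; [lift_var] is convertible to [mwiden], which the
    lemmas use. *)
Let Ht := ideal_gen (rcons (map (@lift_var n K) hs) (lift_var f * tvar n K - 1)).

(** Modulo [Ht] the product u = f t is 1, so g is congruent to g f^N t^N; the difference is a
    multiple of u^N - 1, hence of u - 1. *)
Lemma saturation_lift g N : H (g * f ^+ N) -> Ht (mwiden g).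
Proof.
have idHt : is_ideal Ht by apply: ideal_genP.
have lift_H p : H p -> Ht (mwiden p).
  apply: (@ideal_gen_min _ _ (fun p => Ht (mwiden p))).
    split=> [|a b|a b]; rewrite ?mwiden0 ?mwidenD ?mwidenM.
    - exact: (ideal0 idHt).
    - exact: (idealD idHt).
    - exact: (idealMl idHt).
  by move=> h hs_h; apply: ideal_gen_mem; rewrite mem_rcons inE map_f ?orbT.
move=> /lift_H; rewrite mwidenM rmorphXn /= => Hgf.
set u := mwiden f * tvar n K.
have Hu : Ht (u - 1) by apply: ideal_gen_mem; rewrite mem_rcons mem_head.
rewrite (_ : mwiden g = mwiden g * mwiden f ^+ N * tvar n K ^+ N - mwiden g * (u ^+ N - 1)).
  apply: (idealB idHt); first exact: (idealMr idHt).
  by apply: (idealMl idHt); rewrite subrX1; apply: (idealMr idHt).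
by rewrite exprMn; ring.
Qed.

(** Instead of clearing powers of t, evaluate: if f(a) is nonzero at a zero a of P, then (a, 1/f(a))
    is a zero of [Ht], so g(a) = 0. Thus g f vanishes on V(P) and lies in P. *)
Lemma saturation_prime P g : is_prime_ideal P -> (forall p, H p -> P p) ->
  Ht (mwiden g) -> P g \/ P f.
Proof.
move=> prP HP Htg; apply: (prime_mul prP).
apply/(vanishing_ideal_zero_set iota _ prP) => a Pa.
rewrite evalLE rmorphM -!evalLE.
have [->|nz_f] := eqVneq (evalL iota f a) 0; rewrite ?mulr0 //.
pose J p := evalL iota p (snoc_point a (evalL iota f a)^-1) = 0.
have idJ : is_ideal J.
  rewrite /J; split=> [|p q|p q]; rewrite !evalLE ?rmorph0 ?rmorphD ?rmorphM //.
    by move=> -> ->; rewrite addr0.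
  by move=> ->; rewrite mulr0.
have : J (mwiden g).
  apply: (ideal_gen_min idJ) Htg => p; rewrite mem_rcons inE => /predU1P [->|/mapP [h hs_h ->]].
    rewrite /J evalLE rmorphB rmorphM rmorph1 -!evalLE evalL_snoc_mwiden evalL_snoc_max.
    by rewrite mulfV // subrr.
  by rewrite /J evalL_snoc_mwiden; apply: Pa; apply: HP; apply: ideal_gen_mem.
by rewrite /J evalL_snoc_mwiden => ->; rewrite mul0r.
Qed.

Lemma generally_true_iff : (d <= n)%N ->
  generally_true iota H Y f <-> meets_vars Ht (first_vars_t n d).
Proof.
move=> le_dn; rewrite generally_trueP; split=> [gt|[g [Htg nz vg]] P minP nPY].
  apply: boolp.contrapT => nmeets.
  (* A minimal prime avoiding all g f^N misses K[Y] \ {0} (N = 0) and f (g = 1), against general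
     truth. *)
  have [||_ _ [g [N [gY ->]]] [g' [N' [g'Y ->]]]|_ [g [N [[nz vg] ->]]] Hg|P [minP nPS]] :=
    @minimal_prime_avoiding _ H (fun a => exists g N, nonzeroY g /\ a = g * f ^+ N).
  - exact: ideal_genP.
  - by exists 1, 0%N; rewrite mul1r expr0.
  - exists (g * g'), (N + N')%N; split; first exact: nonzeroYM.
    by rewrite exprD mulrACA.
  - apply: nmeets; exists (mwiden g); rewrite mwiden_eq0; split=> //.
      exact: saturation_lift Hg.
    by apply/in_vars_mwiden; rewrite first_vars_widen.
  apply: (nPS f); first by exists 1, 1%N; rewrite mul1r expr1.
  apply: gt minP _ => -[p [Pp nz vp]]; apply: nPS Pp.
  by exists p, 0%N; rewrite expr0 mulr1.
(* The index n of t is not below d because d <= n, so g does not involve t. *)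
have [|g' def_g] := in_vars_mwidenP _ vg; first by rewrite inE -leqNgt.
have [prP HP _] := minP; rewrite def_g in Htg.
have [Pg'|//] := saturation_prime prP HP Htg; case: nPY; exists g'.
rewrite -mwiden_eq0 -def_g; split=> //.
by move: vg; rewrite def_g => /in_vars_mwiden; rewrite first_vars_widen.
Qed.

Lemma generally_false_iff : max_indep_set H Y ->
  generally_false iota H Y f <-> meets_vars (ideal_gen (rcons hs f)) Y.
Proof.
move=> [_ maxY]; rewrite generally_falseP; split=> [gf|[g [Hfg nz vg]] P [prP HP _] nPY Pf].
  apply: boolp.contrapT => nmeets.
  have [|||g [nz vg] Hg|Q [[prQ HfQ _] nQS]] :=
    @minimal_prime_avoiding _ (ideal_gen (rcons hs f)) nonzeroY => //.
  - exact: ideal_genP.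
  - by apply: nmeets; exists g.
  have HQ p : H p -> Q p.
    apply: ideal_gen_min; first exact: prime_ideal.
    by move=> h hs_h; apply: HfQ; apply: ideal_gen_mem; rewrite mem_rcons inE hs_h orbT.
  have nQY : ~ meets_vars Q Y by case=> p [Qp nz vp]; apply: (nQS p).
  (* Avoiding the complement of Q yields a minimal prime of H inside Q. *)
  have [|||p nQp /HQ //|P [minP PQ]] := @minimal_prime_avoiding _ H (fun p => ~ Q p).
  - exact: ideal_genP.
  - by case: prQ.
  - by move=> a b nQa nQb /(prime_mul prQ) [].
  have {}PQ p : P p -> Q p by move=> Pp; apply: boolp.contrapT => /PQ; apply.
  have [prP HP _] := minP.
  apply: (gf P minP) => [[p [/PQ Qp nz vp]]|]; first by apply: nQY; exists p.
  apply: (prime_over_eq prP prQ PQ nQY) => [i le_di|].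
    (* Y with one more variable exceeds the maximal size, so it is dependent for H and hence for
       P. *)
    have [|p [/HP Pp nz vp]] := maxY (i |: Y); last by exists p.
    by rewrite cardsU1 inE -leqNgt le_di add1n.
  by apply: HfQ; apply: ideal_gen_mem; rewrite mem_rcons mem_head.
apply: nPY; exists g; split=> //; apply: ideal_gen_min Hfg; first exact: prime_ideal.
by move=> p; rewrite mem_rcons inE => /predU1P [->//|hs_p]; apply/HP/ideal_gen_mem.
Qed.
End Components.

Theorem theorem1 (K : fieldType) (L : closedFieldType) (iota : {rmorphism K -> L})
  (n d : nat) (hs : seq {mpoly K[n]}) (f : {mpoly K[n]}) :
  (d <= n)%N ->
  max_indep_set (ideal_gen hs) (first_vars n d) ->
  (generally_true iota (ideal_gen hs) (first_vars n d) f <->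
     meets_vars
       (ideal_gen (rcons (map (@lift_var n K) hs) (lift_var f * tvar n K - 1)))
       (first_vars_t n d))
  /\
  (generally_false iota (ideal_gen hs) (first_vars n d) f <->
     meets_vars (ideal_gen (rcons hs f)) (first_vars n d)).
Proof.
move=> le_dn maxY; split; first exact: generally_true_iff.
exact: generally_false_iff.
Qed.
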